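(* Let $K$ be finite dimensional and suppose there exists $c \ge 0$ such that the penalty function $\Phi_c(\cdot) = f_0(\cdot) + c \operatorname{dist}(F(\cdot), -K)$ is coercive on $Q$. Let also $\mathscr{D}_0 \subseteq \mathscr{D}$ be a nonempty set for which one can find $a > 0$, $L_g > 0$, and $L_h > 0$ such that for any $z \in \mathscr{D}_0$ and $v \in \partial h_0(z)$ one has $\|v\| \le L_h$ and there exist $r > 0$ and a globally optimal solution $x_*$ of the non-penalized problem \[ (\mathrm{NP}_{z,v}) \quad \text{minimize } g_0(x) - \langle v, x \rangle \quad \text{subject to } G(x) - H(z) - D H(z)(x - z) \preceq_K 0, \quad x \in Q \] such that $g_0$ is Lipschitz continuous near $x_*$ with Lipschitz constant $L_g$ and \[ \operatorname{dist}(F_z(x), -K) \ge a \operatorname{dist}(x, M_z^{-1}(0)) \quad \forall x \in B(x_*, r) \cap Q. \] Then there exists $\mu_* \ge 0$ such that for all $\mu \ge \mu_*$ and for any $z \in \mathscr{D}_0$ and $v \in \partial h_0(z)$ there exists a globally optimal solution of the penalized problem \[ (\mathrm{P}_{z,v,\mu}) \quad \min_{(x, s)} \ g_0(x) - \langle v, x \rangle + \mu \langle t_0, s \rangle \quad \text{subject to } G(x) - H(z) - D H(z)(x - z) \preceq_K s, \quad s \succeq_K 0, \quad x \in Q, \] and a pair $(x_*, s_* )$ is a (globally optimal) solution of $(\mathrm{P}_{z,v,\mu})$ if and only if $s_* = 0$ and $x_*$ is a solution of the corresponding non-penalized problem $(\mathrm{NP}_{z,v})$.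
   Context: $g_0, h_0 \colon \mathbb{R}^d \to \mathbb{R}$ are real-valued closed convex functions, $f_0 = g_0 - h_0$; $\partial$ is the convex subdifferential. $Y$ is a real Banach space with dual $Y^*$, $K \subset Y$ is a proper cone (a closed convex cone with $K \cap (-K) = \{0\}$), $x \preceq_K y$ iff $y - x \in K$, $K^* = \{ y^* \in Y^* \mid \langle y^*, y \rangle \ge 0 \ \forall y \in K \}$. The maps $G, H \colon \mathbb{R}^d \to Y$ are $K$-convex ($G(\alpha x_1 + (1-\alpha)x_2) \preceq_K \alpha G(x_1) + (1-\alpha) G(x_2)$ for all $\alpha \in [0,1]$, $x_1,x_2\in\mathbb{R}^d$; similarly for $H$), $H$ is continuously Fréchet differentiable with derivative $DH$, $F = G - H$, and $Q \subseteq \mathbb{R}^d$ is a closed convex set. $t_0 \in Y^*$ is a fixed functional with $t_0 \succ_{K^*} 0$, meaning $t_0 \in K^*$ and $\langle t_0, y \rangle > 0$ for all $y \in K \setminus \{0\}$. For $z \in \mathbb{R}^d$: $F_z(x) = G(x) - H(z) - D H(z)(x - z)$; $M_z(x) = F_z(x) + K$ if $x \in Q$ and $M_z(x) = \emptyset$ if $x \notin Q$; thus $M_z^{-1}(0) = \{ x \in Q \mid F_z(x) \preceq_K 0\}$. $\mathscr{D} = \{ z \in Q \mid \exists x \in Q \colon F_z(x) \preceq_K 0 \}$. $B(x, r)$ is the closed ball. A function $\varphi \colon \mathbb{R}^d \to \mathbb{R}$ is coercive on $Q$ if $\varphi(x_n) \to +\infty$ for any sequence $\{x_n\} \subset Q$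 with $\|x_n\| \to +\infty$. *)

(* Defs.v *)
From HB Require Import structures.
From mathcomp Require Import all_boot all_order all_algebra.
From mathcomp Require Import all_classical all_reals all_analysis.
Set Implicit Arguments.
Unset Strict Implicit.
Unset Printing Implicit Defensive.
Import Order.TTheory GRing.Theory Num.Theory.
Import numFieldNormedType.Exports.
Local Open Scope classical_set_scope.
Local Open Scope ring_scope.

Section euclidean.
Context {R : realType} {d : nat}.
Implicit Types (x y z v : 'rV[R]_d) (f : 'rV[R]_d -> R).

Definition dotv x y : R := \sum_(i < d) x 0 i * y 0 i.

(* The norm that the library puts on 'rV[R]_d is the sup norm; it induces the
   same topology, but Lipschitz constants, balls and distances on R^d are taken
   with respect to the Euclidean norm. *)
Definition enorm x : R := Num.sqrt (dotv x x).

Definition eball x (r : R) : set 'rV[R]_d := [set y | enorm (y - x) <= r].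

(* A real-valued function is closed when it is lower semicontinuous. *)
Definition closed_convex_fun f : Prop :=
  convex_function setT f /\ lower_semicontinuous (EFin \o f).

Definition subdiff f z : set 'rV[R]_d :=
  [set v | forall x, f z + dotv v (x - z) <= f x].

Definition lipschitz_near f x (L : R) : Prop :=
  exists2 U : set 'rV[R]_d, nbhs x U &
    forall y z, U y -> U z -> `|f y - f z| <= L * enorm (y - z).

Definition coercive_on (Q : set 'rV[R]_d) f : Prop :=
  forall u : nat -> 'rV[R]_d, (forall n, Q (u n)) ->
    enorm (u n) @[n --> \oo] --> +oo -> f (u n) @[n --> \oo] --> +oo.

End euclidean.

(* Real-valued infimum: only meaningful for a nonempty set A. *)
Definition dist_to {R : realType} {V : zmodType} (N : V -> R) (x : V)
  (A : set V) : R := inf [set N (x - a) | a in A].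

Definition optimal_solution {R : realType} {T : Type} (A : set T) (f : T -> R)
  (x : T) : Prop := A x /\ forall y, A y -> f x <= f y.

Section cones.
Context {R : realType} {Y : completeNormedModType R}.
Implicit Type K : set Y.

Definition proper_cone K : Prop :=
  [/\ closed K, convex_set K,
      forall (a : R) (y : Y), 0 <= a -> K y -> K (a *: y) &
      K `&` -%R @` K = [set 0]].

Definition leK K (x y : Y) : Prop := K (y - x).

(* The linear span of K has finite dimension. *)
Definition finite_dim_cone K : Prop :=
  exists (n : nat) (e : 'I_n -> Y), forall y, K y ->
    exists c : 'I_n -> R, y = \sum_(i < n) c i *: e i.

Definition dual_cone K : set {linear Y -> R^o} :=
  [set t : {linear Y -> R^o} | continuous t /\ forall y, K y -> 0 <= t y :> R].

Definition strictly_positive K (t : {linear Y -> R^o}) : Prop :=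
  dual_cone K t /\ forall y, K y -> y != 0 -> 0 < t y :> R.

Definition distY (y : Y) (A : set Y) : R := dist_to Num.norm y A.

End cones.

Section problem.
Context {R : realType} {d : nat} {Y : completeNormedModType R}.
Implicit Types (K : set Y) (Q : set 'rV[R]_d) (G H : 'rV[R]_d -> Y).
Implicit Types (x z v : 'rV[R]_d).

Definition K_convex K G : Prop :=
  forall (a : R) x y, 0 <= a <= 1 ->
    leK K (G (a *: x + (1 - a) *: y)) (a *: G x + (1 - a) *: G y).

(* Continuity of z |-> 'd H z is with respect to the operator norm. *)
Definition continuously_differentiable H : Prop :=
  (forall z, differentiable H z) /\
  forall z (e : R), 0 < e -> \forall z' \near z,
    forall u : 'rV[R]_d, `|'d H z' u - 'd H z u| <= e * enorm u.

Definition linF G H z x : Y := G x - H z - 'd H z (x - z).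

Definition multiM K Q G H z x : set Y :=
  [set y | Q x /\ exists2 k, K k & y = linF G H z x + k].

Definition Minv0 K Q G H z : set 'rV[R]_d := [set x | multiM K Q G H z x 0].

Definition domD K Q G H : set 'rV[R]_d :=
  [set z | Q z /\ exists2 x, Q x & leK K (linF G H z x) 0].

Definition optNP K Q G H (g0 : 'rV[R]_d -> R) z v x : Prop :=
  optimal_solution [set x' | leK K (linF G H z x') 0 /\ Q x']
    (fun x' => g0 x' - dotv v x') x.

Definition optP K Q G H (g0 : 'rV[R]_d -> R) (t0 : {linear Y -> R^o})
    z v (mu : R) (p : 'rV[R]_d * Y) : Prop :=
  optimal_solution
    [set q : 'rV[R]_d * Y |
      [/\ leK K (linF G H z q.1) q.2, leK K 0 q.2 & Q q.1]]
    (fun q => g0 q.1 - dotv v q.1 + mu * t0 q.2) p.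

End problem.

(* Main.v *)
(* On a finite-dimensional proper cone the strictly positive t0 dominates a
   multiple of the norm, so t0 s bounds dist(F_z(x), -K) from above whenever
   F_z(x) <= s in the order of K.  Near the given solution of the non-penalized
   problem, the error bound and the Lipschitz constants Lg, Lh make
   dist(F_z(.), -K), with coefficient (Lg + Lh) / a, an exact penalty term;
   convexity extends this from the neighbourhood to all of Q.  The resulting
   threshold depends only on a, Lg, Lh and t0, not on z and v. *)
Require Import Defs.
From HB Require Import structures.
From mathcomp Require Import all_boot all_order all_algebra.
From mathcomp Require Import all_classical all_reals all_analysis.
From mathcomp Require Import ring lra.
Import Order.TTheory GRing.Theory Num.Theory.
Import numFieldNormedType.Exports.
Local Open Scope classical_set_scope.
Local Open Scope ring_scope.

(** * Euclidean inner product and norm *)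

Section euclidean.
Set Implicit Arguments.
Unset Strict Implicit.
Context {R : realType} {d : nat}.
Implicit Types (x y z v : 'rV[R]_d).

Lemma dotvDr v x y : dotv v (x + y) = dotv v x + dotv v y.
Proof. by rewrite -big_split; apply: eq_bigr => i _; rewrite mxE mulrDr. Qed.

Lemma dotvZr v a x : dotv v (a *: x) = a * dotv v x.
Proof. by rewrite big_distrr; apply: eq_bigr => i _; rewrite mxE mulrCA. Qed.

Lemma dotvC x y : dotv x y = dotv y x.
Proof. by apply: eq_bigr => i _; rewrite mulrC. Qed.

Lemma dotvBr v x y : dotv v (x - y) = dotv v x - dotv v y.
Proof. by rewrite dotvDr -scaleN1r dotvZr mulN1r. Qed.

Lemma dotv_ge0 x : 0 <= dotv x x.
Proof. by apply: sumr_ge0 => i _; rewrite -expr2 sqr_ge0. Qed.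

Lemma enorm_ge0 x : 0 <= enorm x.
Proof. exact: sqrtr_ge0. Qed.

Lemma enormZ a x : 0 <= a -> enorm (a *: x) = a * enorm x.
Proof.
move=> a0; rewrite /enorm dotvZr dotvC dotvZr mulrA -expr2.
by rewrite sqrtrM ?sqr_ge0// sqrtr_sqr ger0_norm.
Qed.

Lemma sqr_enorm x : enorm x ^+ 2 = dotv x x.
Proof. exact/sqr_sqrtr/dotv_ge0. Qed.

Lemma enormBC x y : enorm (x - y) = enorm (y - x).
Proof.
by congr Num.sqrt; apply: eq_bigr => i _; rewrite !mxE -mulrNN !opprB.
Qed.

Lemma coord_le_enorm x i : `|x 0 i| <= enorm x.
Proof.
rewrite -sqrtr_sqr ler_wsqrtr// /dotv (bigD1 i)//= -expr2 lerDl.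
by apply: sumr_ge0 => j _; rewrite -expr2 sqr_ge0.
Qed.

(** Neighbourhoods contain sup-norm balls; this bound lets Euclidean estimates place points in
    them. *)
Lemma norm_le_enorm x : `|x| <= enorm x.
Proof.
rewrite [leLHS]/Num.norm /= mx_normrE; apply/bigmax_leP; split=> [|[i j] _ /=].
  exact: enorm_ge0.
by rewrite (ord1 i) coord_le_enorm.
Qed.

(** Cauchy-Schwarz: for nonzero norms, expand the square of [enorm y *: x - enorm x *: y], which is
    nonnegative. *)
Lemma dotv_le x y : dotv x y <= enorm x * enorm y.
Proof.
have [x0|xN0] := eqVneq (enorm x) 0.
  rewrite x0 mul0r /dotv big1// => i _.
  have := coord_le_enorm x i; rewrite x0 normr_le0 => /eqP ->.
  by rewrite mul0r.
have [y0|yN0] := eqVneq (enorm y) 0.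
  rewrite y0 mulr0 /dotv big1// => i _.
  have := coord_le_enorm y i; rewrite y0 normr_le0 => /eqP ->.
  by rewrite mulr0.
have p0 : 0 < enorm x by rewrite lt_def xN0 enorm_ge0.
have q0 : 0 < enorm y by rewrite lt_def yN0 enorm_ge0.
have := dotv_ge0 (enorm y *: x - enorm x *: y).
rewrite dotvBr !dotvZr ![dotv (_ - _) _]dotvC !dotvBr !dotvZr (dotvC y x).
rewrite -!sqr_enorm => h.
rewrite -subr_ge0 -(pmulr_rge0 _ (mulr_gt0 p0 q0)); nra.
Qed.

End euclidean.

(** * Distance to a set as an infimum *)

Section dist_to.
Set Implicit Arguments.
Unset Strict Implicit.
Context {R : realType} {V : zmodType} (N : V -> R).
Hypothesis N_ge0 : forall x, 0 <= N x.

Lemma dist_to_le x (A : set V) a : A a -> dist_to N x A <= N (x - a).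
Proof.
move=> Aa; apply: ge_inf; last by exists a.
by exists 0 => _ [b _ <-].
Qed.

Lemma dist_to_adherent x (A : set V) e : A !=set0 -> 0 < e ->
  exists2 a, A a & N (x - a) < dist_to N x A + e.
Proof.
move=> [a Aa] e0.
have [|_ [b Ab <-] h] := @inf_adherent _ [set N (x - a) | a in A] e e0.
  by split; [exists (N (x - a)), a|exists 0 => _ [b _ <-]].
by exists b.
Qed.

End dist_to.

(** * Proper cones and strictly positive functionals *)

Section cones.
Set Implicit Arguments.
Unset Strict Implicit.
Context {R : realType} {Y : completeNormedModType R} (K : set Y).

Lemma convex_set_combination {V : lmodType R} (A : set V) (t : R) x y :
  convex_set A -> 0 <= t <= 1 -> A x -> A y -> A (t *: x + (1 - t) *: y).
Proof.
move=> cA /andP[t0 t1] Ax Ay.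
by have := cA x y (Itv01 t0 t1) (mem_set Ax) (mem_set Ay); rewrite inE.
Qed.

Hypothesis K_proper : proper_cone K.

Lemma proper_cone0 : K 0.
Proof.
have [_ _ _ K0] := K_proper.
by have : [set 0] (0 : Y) by []; rewrite -K0 => -[].
Qed.

Lemma proper_coneZ a y : 0 <= a -> K y -> K (a *: y).
Proof. by have [_ _ + _] := K_proper; exact. Qed.

(** The sum is twice the midpoint, which convexity keeps in the cone. *)
Lemma proper_coneD x y : K x -> K y -> K (x + y).
Proof.
have [_ cK _ _] := K_proper => Kx Ky.
have h : 0 <= (2^-1 : R) <= 1 by lra.
have := proper_coneZ (ler0n _ 2) (convex_set_combination cK h Kx Ky).
rewrite scalerDr !scalerA (_ : 2 * (1 - 2^-1) = 1); last by field.
by rewrite divff ?pnatr_eq0// !scale1r.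
Qed.

(** The point [y - s] lies in -K, at distance [|s|] from [y]. *)
Lemma distY_le y s : K s -> K (s - y) -> distY y (-%R @` K) <= `|s|.
Proof.
move=> Ks Kys; have -> : s = y - - (s - y) by rewrite opprK subrKC.
by apply: dist_to_le => //; exists (s - y).
Qed.

Lemma continuous_lincomb n (e : 'I_n -> Y) :
  continuous (fun c : 'rV[R]_n => \sum_(i < n) c 0 i *: e i).
Proof.
apply: continuous_big => [|i _ c]; first exact: add_continuous.
apply: cvgZr_tmp; [exact: nbhs_filter|exact: coord_continuous].
Qed.

Lemma norm_lincomb_le n (e : 'I_n -> Y) :
  exists2 C : R, 0 < C &
    forall c : 'rV[R]_n, `|\sum_(i < n) c 0 i *: e i| <= C * `|c|.
Proof.
(* The summand 1 keeps the constant positive when every [e i] vanishes. *)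
exists (1 + \sum_(i < n) `|e i|).
  by rewrite ltr_pwDl// sumr_ge0.
move=> c; rewrite mulrDl mul1r; apply: ler_wpDl => //.
rewrite mulr_suml; apply: (le_trans (ler_norm_sum _ _ _)).
apply: ler_sum => i _; rewrite normrZ mulrC ler_wpM2l//.
rewrite [leRHS]/Num.norm /= mx_normrE.
by apply/bigmax_geP; right => /=; exists (0, i).
Qed.

(* Induction on n removes a dependent vector; for independent vectors,
   t / norm is bounded below on the cone by compactness of the unit sphere of
   the coordinate space. *)
Lemma strictly_positive_norm_le (t : {linear Y -> R^o}) :
  strictly_positive K t -> finite_dim_cone K ->
  exists2 k : R, 0 < k & forall y, K y -> k * `|y| <= t y.
Proof.
move=> [[t_cont t_ge0] t_gt0] [n [e]].
elim: n e => [|n IH] e spanK.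
  exists 1 => // y /[dup] Ky /spanK[c ->].
  by rewrite big_ord0 normr0 mulr0 linear0.
pose phi (c : 'rV[R]_n.+1) := \sum_(i < n.+1) c 0 i *: e i.
have [[c [c0 phic0]]|indep] :=
    pselect (exists c : 'rV[R]_n.+1, c != 0 /\ phi c = 0).
  have [j cj0] : exists j, c 0 j != 0.
    apply: contrapT => h; move/eqP: c0; apply; apply/rowP => j; rewrite mxE.
    by apply/eqP/negPn/negP => cj; apply: h; exists j.
  apply: (IH (e \o lift j)) => y Ky; have [b yE] := spanK _ Ky.
  (* Subtracting the multiple [b j / c 0 j] of the relation [phi c = 0] removes the coefficient of
     [e j]. *)
  exists (fun i => b (lift j i) - b j / c 0 j * c 0 (lift j i)).
  have -> : y = y - (b j / c 0 j) *: phi c by rewrite phic0 scaler0 subr0.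
  rewrite yE /phi scaler_sumr -sumrB (bigD1_ord j)//= scalerA divfK// subrr add0r.
  by apply: eq_bigr => i _; rewrite scalerBl scalerA.
have phi_cont : continuous phi := @continuous_lincomb _ e.
have phiZ a c : phi (a *: c) = a *: phi c.
  by rewrite scaler_sumr; apply: eq_bigr => i _; rewrite mxE scalerA.
have [C C0 phi_le] := norm_lincomb_le e.
pose S := [set c | `|c| = 1 /\ K (phi c)].
have S_compact : compact S.
  apply: bounded_closed_compact.
    by exists 1; split => // M M1 c [c1 _]; rewrite /= c1 ltW.
  have [Kcl _ _ _] := K_proper.
  apply: closedI.
    apply: (closed_comp (D := [set 1]) (f := fun c : 'rV[R]_n.+1 => `|c|)).
      by move=> c _; exact: norm_continuous.
    exact: closed_eq.
  by apply: (closed_comp (f := phi)) => // c _; exact: phi_cont.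
have S_scale c : c != 0 -> K (phi c) -> S (`|c|^-1 *: c).
  move=> c0 Kc; split; last by rewrite phiZ; apply: proper_coneZ.
  by rewrite normrZ normfV normr_id mulVf// normr_eq0.
have [k k0 kS] : exists2 k : R, 0 < k & forall c, S c -> k <= t (phi c).
  (* If [S] is empty the bound is vacuous; otherwise its minimum over [S] is attained, and is
     positive because [phi] is injective at 0. *)
  have [S0|/set0P/negP] := pselect (S !=set0); last first.
    by rewrite negbK => /eqP ->; exists 1.
  have tphi_cont : {within S, continuous (fun c => t (phi c) : R)}.
    apply: continuous_subspaceT => c.
    exact: (continuous_comp (phi_cont c) (t_cont _)).
  have [c] := EVT_min_rV S0 S_compact tphi_cont.
  rewrite inE => -[c1 Kc] cmin; exists (t (phi c)).
    apply: t_gt0 => //; apply/eqP => phic0; apply: indep; exists c; split=> //.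
    by rewrite -normr_gt0 c1.
  by move=> c' Sc'; apply: cmin; rewrite inE.
(* [k] bounds [t] below by the norm of the coordinates, and [C] converts that norm into the norm of
   Y. *)
exists (k / C) => [|y Ky]; first exact: divr_gt0.
have [b yE] := spanK _ Ky; pose c := \row_i b i.
have {}yE : y = phi c.
  by rewrite yE; apply: eq_bigr => i _; rewrite mxE.
have [c0|c0] := eqVneq c 0.
  have -> : y = 0 by rewrite yE c0 -(scale0r (0 : 'rV[R]_n.+1)) phiZ scale0r.
  by rewrite normr0 mulr0 linear0.
rewrite yE in Ky *.
have cgt0 : 0 < `|c| by rewrite normr_gt0.
have := kS _ (S_scale _ c0 Ky); rewrite phiZ linearZ /= => h.
have {h} : k * `|c| <= t (phi c).
  by rewrite -ler_pdivlMr// mulrC.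
apply: le_trans; rewrite -mulrA ler_pM2l// mulrC ler_pdivrMr// mulrC.
exact: phi_le.
Qed.

End cones.

(** * Exact penalty estimates for the convexified problem *)

Section exact_penalty.
Set Implicit Arguments.
Unset Strict Implicit.
Context {R : realType} {d : nat} {Y : completeNormedModType R}.
Context (K : set Y) (Q : set 'rV[R]_d) (G H : 'rV[R]_d -> Y).
Context (g0 : 'rV[R]_d -> R).
Implicit Types (x z v xs : 'rV[R]_d).

Lemma Minv0P z x : Minv0 K Q G H z x <-> leK K (linF G H z x) 0 /\ Q x.
Proof.
rewrite /leK sub0r; split => [[Qx [k Kk /esym/eqP]]|[Kx Qx]].
  by rewrite addr_eq0 => /eqP ->; rewrite opprK.
by split => //; exists (- linF G H z x) => //; rewrite subrr.
Qed.

(** The terms subtracted from [G] are affine in the variable, so they cancel and leave the convexity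
    gap of [G]. *)
Lemma linF_convex z t x y : K_convex K G -> 0 <= t <= 1 ->
  leK K (linF G H z (t *: x + (1 - t) *: y))
    (t *: linF G H z x + (1 - t) *: linF G H z y).
Proof.
move=> G_convex t01; have := G_convex t x y t01; rewrite /leK /linF; congr K.
have -> : t *: x + (1 - t) *: y - z = t *: (x - z) + (1 - t) *: (y - z).
  by apply/rowP => i; rewrite !mxE; ring.
have comb a b c a' b' c' : t *: (a - b - c) + (1 - t) *: (a' - b' - c') =
    t *: a + (1 - t) *: a' - (t *: b + (1 - t) *: b') - (t *: c + (1 - t) *: c') :> Y.
  by rewrite !scalerBr !opprD addrACA; congr (_ + _); rewrite addrACA.
have cancel (p q b c : Y) : p - b - c - (q - b - c) = p - q.
  by rewrite -2![_ - b - c]addrA opprD addrACA subrr addr0.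
have -> : 'd H z (t *: (x - z) + (1 - t) *: (y - z)) =
    t *: 'd H z (x - z) + (1 - t) *: 'd H z (y - z).
  by rewrite (linearD ('d H z)) !(linearZZ ('d H z)).
rewrite comb -(scalerDl (H z)) subrKC scale1r.
by rewrite cancel.
Qed.

(** Compare [x] with a nearly closest feasible [x']: optimality gives the inequality at [x'], and
    moving back to [x] costs at most [Lg + Lh] times a distance that the error bound controls. *)
Lemma local_exact_penalty z v xs (a r Lg Lh : R) :
    0 < a -> 0 < r -> 0 < Lg -> 0 < Lh -> enorm v <= Lh ->
    optNP K Q G H g0 z v xs -> lipschitz_near g0 xs Lg ->
    (forall x, eball xs r x -> Q x ->
       a * dist_to enorm x (Minv0 K Q G H z)
         <= distY (linF G H z x) (-%R @` K)) ->
  exists2 delta : R, 0 < delta &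
    forall x, Q x -> enorm (x - xs) <= delta ->
      g0 xs - dotv v xs <= g0 x - dotv v x
        + (Lg + Lh) / a * distY (linF G H z x) (-%R @` K).
Proof.
move=> a0 r0 Lg0 Lh0 vLh [feas_xs opt_xs] [U /nbhs_ballP[rho /= rho0 subU] lipU].
(* With [x] within [rho / 4] of [xs], the point [x'] chosen below is within [rho / 2] of [x], hence
   still in [U]. *)
move=> reg; exists (Num.min r (rho / 4)); first by rewrite lt_min r0 divr_gt0.
move=> x Qx; rewrite le_min => /andP[xr xrho].
set D := distY _ _; have L0 : 0 < Lg + Lh by rewrite addr_gt0.
have inU y : `|y - xs| < rho -> U y.
  by move=> h; apply: subU; rewrite -ball_normE /ball_ /= distrC.
have Ux : U x by apply: inU; have := norm_le_enorm (x - xs); lra.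
have Mxs : Minv0 K Q G H z xs by apply/Minv0P.
have dist_le := @dist_to_le _ _ _ (@enorm_ge0 R d) x _ _ Mxs.
have {}reg : dist_to enorm x (Minv0 K Q G H z) <= D / a.
  by rewrite ler_pdivlMr// mulrC; apply: reg.
apply/ler_addgt0Pr => e e0.
(* The infimum need not be attained; an excess of [e / (Lg + Lh)] in distance costs at most [e] in
   the objective. *)
have e'0 : 0 < Num.min (e / (Lg + Lh)) (rho / 4).
  by rewrite lt_min !divr_gt0.
have [x' Mx'] := @dist_to_adherent _ _ _ (@enorm_ge0 R d) x _ _
  (ex_intro _ _ Mxs) e'0.
rewrite -ltrBlDl lt_min => /andP[x'e x'rho].
have Ux' : U x'.
  apply: inU; have := ler_distD x x' xs; have := norm_le_enorm (x - xs).
  by have := norm_le_enorm (x' - x); rewrite (enormBC x'); lra.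
have gle : g0 x' - g0 x <= Lg * enorm (x - x').
  by rewrite enormBC; apply: le_trans (ler_norm _) (lipU _ _ Ux' Ux).
have vle : dotv v x - dotv v x' <= Lh * enorm (x - x').
  rewrite -dotvBr; apply: le_trans (dotv_le _ _) _.
  by rewrite ler_wpM2r ?enorm_ge0.
have := opt_xs x' ((Minv0P _ _).1 Mx') => /= fle.
have : (Lg + Lh) * enorm (x - x') <= (Lg + Lh) / a * D + e.
  rewrite mulrAC -mulrA -[e](mulfVK (lt0r_neq0 L0)) [e / _ * _]mulrC -mulrDr.
  by rewrite ler_pM2l//; lra.
by lra.
Qed.

Hypotheses (K_proper : proper_cone K) (Q_convex : convex_set Q).
Hypotheses (G_convex : K_convex K G) (g0_convex : convex_function setT g0).

(* Moving from xs a small fraction t of the way to x scales the slack s by t,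
   so the local estimate at xs transfers to all of Q. *)
Lemma global_exact_penalty z v xs (c delta : R) : 0 <= c -> 0 < delta ->
    leK K (linF G H z xs) 0 -> Q xs ->
    (forall x, Q x -> enorm (x - xs) <= delta ->
      g0 xs - dotv v xs <= g0 x - dotv v x
        + c * distY (linF G H z x) (-%R @` K)) ->
  forall x s, leK K (linF G H z x) s -> leK K 0 s -> Q x ->
    g0 xs - dotv v xs <= g0 x - dotv v x + c * `|s|.
Proof.
rewrite /leK sub0r => c0 delta0 Kxs Qxs loc x s Kx; rewrite subr0 => Ks Qx.
(* Adding 1 keeps the denominator positive when [x = xs]. *)
pose t := Num.min 1 (delta / (enorm (x - xs) + 1)).
have E0 := enorm_ge0 (x - xs).
have t0 : 0 < t by rewrite lt_min ltr01 divr_gt0//; lra.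
have t1 : t <= 1 by rewrite ge_min lexx.
have t01 : 0 <= t <= 1 by rewrite ltW.
have te : t * enorm (x - xs) <= delta.
  have : t <= delta / (enorm (x - xs) + 1) by rewrite ge_min lexx orbT.
  by rewrite ler_pdivlMr; nra.
pose xt := t *: x + (1 - t) *: xs.
have xtE : xt - xs = t *: (x - xs).
  by apply/rowP => i; rewrite !mxE; ring.
have := loc xt (convex_set_combination Q_convex t01 Qx Qxs).
rewrite xtE (enormZ _ (ltW t0)) => /(_ te).
(* In the order of K, F_z(xt) is at most t F_z(x) + (1 - t) F_z(xs), and F_z(xs) is at most 0. *)
have Kxt : K (t *: s - linF G H z xt).
  have := proper_coneD K_proper (linF_convex z x xs G_convex t01)
    (proper_coneD K_proper (proper_coneZ K_proper (ltW t0) Kx)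
      (proper_coneZ K_proper (_ : 0 <= 1 - t) Kxs)).
  rewrite subr_ge0 => /(_ t1); congr K.
  have cancel (p A B C : Y) : A + B - C + (p - A - B) = p - C.
    by rewrite -[p - A - B]addrA -opprD [LHS]addrC [LHS]addrA subrK.
  by rewrite (scalerBr t s) scalerN cancel.
have := distY_le (proper_coneZ K_proper (ltW t0) Ks) Kxt.
rewrite normrZ gtr0_norm// => dle.
have gle : g0 xt <= t * g0 x + (1 - t) * g0 xs.
  exact: (g0_convex (Itv01 (ltW t0) t1) (in_setT x) (in_setT xs)).
rewrite dotvDr !dotvZr => h.
have cd := ler_wpM2l c0 dle.
(* The share [1 - t] of the value at [xs] cancels, and what remains is the claim multiplied by
   [t]. *)
rewrite -(ler_pM2l t0); nra.
Qed.

End exact_penalty.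

Theorem proposition2 (R : realType) (d : nat) (Y : completeNormedModType R)
  (K : set Y) (Q : set 'rV[R]_d) (G H : 'rV[R]_d -> Y)
  (g0 h0 : 'rV[R]_d -> R) (t0 : {linear Y -> R^o}) (D0 : set 'rV[R]_d)
  (g0_closed_convex : closed_convex_fun g0)
  (h0_closed_convex : closed_convex_fun h0)
  (K_proper : proper_cone K)
  (G_convex : K_convex K G)
  (H_convex : K_convex K H)
  (H_C1 : continuously_differentiable H)
  (Q_closed : closed Q)
  (Q_convex : convex_set Q)
  (t0_pos : strictly_positive K t0)
  (K_findim : finite_dim_cone K)
  (penalty_coercive : exists2 c : R, 0 <= c &
    coercive_on Q
      (fun x => g0 x - h0 x + c * distY (G x - H x) (-%R @` K)))
  (D0_sub : D0 `<=` domD K Q G H)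
  (D0_nonempty : D0 !=set0)
  (D0_regular : exists a Lg Lh : R, [/\ 0 < a, 0 < Lg, 0 < Lh &
    forall z v, D0 z -> subdiff h0 z v ->
      enorm v <= Lh /\
      exists (r : R) (xs : 'rV[R]_d),
        [/\ 0 < r, optNP K Q G H g0 z v xs, lipschitz_near g0 xs Lg &
            forall x, eball xs r x -> Q x ->
              a * dist_to enorm x (Minv0 K Q G H z)
                <= distY (linF G H z x) (-%R @` K)]]) :
  exists2 mus : R, 0 <= mus &
    forall mu : R, mus <= mu ->
    forall z v, D0 z -> subdiff h0 z v ->
      (exists p, optP K Q G H g0 t0 z v mu p) /\
      forall (xs : 'rV[R]_d) (ss : Y),
        optP K Q G H g0 t0 z v mu (xs, ss) <->
        ss = 0 /\ optNP K Q G H g0 z v xs.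
Proof.
have [k k0 kK] := strictly_positive_norm_le K_proper t0_pos K_findim.
have [a [Lg [Lh [a0 Lg0 Lh0 reg]]]] := D0_regular.
pose c := (Lg + Lh) / a.
have c0 : 0 < c by rewrite divr_gt0 ?addr_gt0.
(* The added 1 makes [c < mu * k] strict, which later forces the slack to vanish. *)
exists (c / k + 1) => [|mu mu_ge z v D0z dv].
  by rewrite addr_ge0// divr_ge0// ltW.
have ck : c < mu * k by rewrite -ltr_pdivrMr//; lra.
have mu0 : 0 < mu by have := divr_gt0 c0 k0; lra.
have [vLh [r [xb [r0 xb_opt xb_lip xb_reg]]]] := reg z v D0z dv.
have [[Kxb Qxb] xb_min] := xb_opt.
have [delta delta0 loc] :=
  local_exact_penalty a0 r0 Lg0 Lh0 vLh xb_opt xb_lip xb_reg.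
have pen := global_exact_penalty K_proper Q_convex G_convex g0_closed_convex.1
  (ltW c0) delta0 Kxb Qxb loc.
(* Since [t0 s] is at least [k * |s|], the penalized objective exceeds the optimal value of (NP) by
   a positive multiple of [|s|]. *)
have obj x s : leK K (linF G H z x) s -> leK K 0 s -> Q x ->
    g0 xb - dotv v xb + (mu * k - c) * `|s| <= g0 x - dotv v x + mu * t0 s.
  move=> Kx Ks Qx; have := pen x s Kx Ks Qx.
  move: Ks; rewrite /leK subr0 => /kK/(ler_wpM2l (ltW mu0)); lra.
have K0 : leK K 0 0 by rewrite /leK subrr; exact: proper_cone0.
have optP0 x : optNP K Q G H g0 z v x -> optP K Q G H g0 t0 z v mu (x, 0).
  move=> [[Kx Qx] x_min]; split => [//|[y s] [/= Ky Ks Qy]].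
  rewrite linear0 mulr0 addr0.
  apply: le_trans (obj y s Ky Ks Qy).
  apply: le_trans (x_min xb (conj Kxb Qxb)) _.
  by rewrite lerDl mulr_ge0// subr_ge0 ltW.
split=> [|xs ss]; first by exists (xb, 0); exact: optP0.
split=> [[[/= Kxs Kss Qxs] xs_min]|[-> /optP0//]].
(* Comparison with [(xb, 0)] bounds the value at [(xs, ss)] by the optimal value of (NP); with [obj]
   this gives [ss = 0]. *)
have := xs_min (xb, 0); rewrite /= linear0 mulr0 addr0 => /(_ (And3 Kxb K0 Qxb)).
move=> le_xb.
have ss0 : ss = 0.
  apply/normr0_eq0/eqP; rewrite -normr_le0 normr_id.
  by have := obj xs ss Kxs Kss Qxs; rewrite -(pmulr_rle0 _ (_ : 0 < mu * k - c)); lra.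
move: Kxs le_xb; rewrite ss0 linear0 mulr0 addr0 => Kxs le_xb.
split => //; split => // y /xb_min; exact: le_trans.
Qed.
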